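(* Let $G = AB$ be a finite group which is the mutually permutable product of the subgroups $A$ and $B$, and let $p$ be a prime. Suppose that for every prime power order $p$-regular element $x\in A\cup B$, $|x^{G}|$ is not divisible by $p^{2}$. If $G$ is $p$-soluble, then $G$ is $p$-supersoluble.
   Context: $G=AB$ is the mutually permutable product of the subgroups $A$ and $B$ if $G=\{ab : a\in A,\ b\in B\}$, $A$ permutes with every subgroup of $B$ (i.e. $AY=YA$ for every subgroup $Y\leqslant B$) and $B$ permutes with every subgroup of $A$. For $x\in G$, $x^G=\{g^{-1}xg : g\in G\}$ is its conjugacy class in $G$, and $|x^G|$ is its size. An element is $p$-regular if its order is not divisible by $p$. A finite group is $p$-soluble if each of its chief factors is either a $p$-group or a $p'$-group (order not divisible by $p$), and $p$-supersoluble if each of its chief factors is either of order $p$ or a $p'$-group. *)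

(* Defs.v *)
From mathcomp Require Import all_boot all_fingroup all_solvable.

Set Implicit Arguments.
Unset Strict Implicit.
Unset Printing Implicit Defensive.

Local Open Scope group_scope.

Definition permutes_with_subgroups (gT : finGroupType) (A B : {group gT}) :=
  forall Y : {group gT}, Y \subset B -> A * Y = Y * A.

Definition mutually_permutable_product (gT : finGroupType)
    (G A B : {group gT}) :=
  [/\ A * B = G, permutes_with_subgroups A B & permutes_with_subgroups B A].

Definition prime_power_order (gT : finGroupType) (x : gT) :=
  exists q k : nat, [/\ prime q, (0 < k)%N & #[x] = (q ^ k)%N].

(* In [chief_factor G V U] the smaller group V comes first: the factor is
   U / V. *)
Definition p_soluble (p : nat) (gT : finGroupType) (G : {group gT}) :=
  forall V U : {group gT}, chief_factor G V U ->
    p.-group (U / V) \/ p^'.-group (U / V).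

Definition p_supersoluble (p : nat) (gT : finGroupType) (G : {group gT}) :=
  forall V U : {group gT}, chief_factor G V U ->
    #|U / V| = p \/ p^'.-group (U / V).

(* Main.v *)
Require Import Defs.
From mathcomp Require Import all_boot all_fingroup all_solvable.

(* Passing to a quotient, let N be a minimal normal p-subgroup of G, C its
   centraliser and H = G / C, so that O_p(H) = 1.  If x in A or B is a
   p-regular element of prime power order acting nontrivially on N, then
   |N : C_N(x)| divides |x^G|, so it is exactly p, and the class of the image
   of x in H has p'-size.  Moreover N_H(<x>) = C_H(x), because the commutator
   of x with an element normalising <x> acts trivially on C_N(x) and on the
   factor N / C_N(x) of order p.  Similarly, modulo C, every q-subgroup of A
   or B with q <> p embeds in the automorphism group of such a factor, so it
   is cyclic.

   By Hall-Higman all these elements of H lie in K = O_p'(H), and by Burnside's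
   transfer A :&: K and B :&: K are cyclic.  Mutual permutability then yields
   x <> 1 of prime order in A :&: K or B :&: K with <x> normal in H: any x in
   A :&: B :&: K will do if this is nontrivial; otherwise x in A :&: K works,
   since the p-elements of B normalise A :&: K, and for b in B of prime power
   order prime to p the product <x><b> is a group, in which x and b are shown
   to commute.  Hence C_N(x) is normal in G, so it is trivial and
   |N| = |N : C_N(x)| = p. *)

Set Implicit Arguments.
Unset Strict Implicit.
Unset Printing Implicit Defensive.

Local Open Scope group_scope.

(** * Burnside's transfer for abelian Sylow subgroups *)

(** Being abelian, [P] and [P :^ y] are both Sylow in ['C_G[u ^ y]]. Some [c] there conjugates the
    second to the first, and [y * c] normalises, hence centralises, [P]. *)
Lemma abelian_Sylow_fusion (gT : finGroupType) (p : nat) (G P : {group gT})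
    (u y : gT) :
  p.-Sylow(G) P -> abelian P -> 'N_G(P) \subset 'C(P) ->
  u \in P -> y \in G -> u ^ y \in P -> u ^ y = u.
Proof.
move=> sylP abP sNC Pu Gy Puy; have sPG := pHall_sub sylP.
have sylC (Q : {group gT}) : p.-Sylow(G) Q -> abelian Q -> u ^ y \in Q ->
    p.-Sylow('C_G[u ^ y]) Q.
  move=> sylQ abQ Qu; apply: (pHall_subl _ (subsetIl _ _) sylQ).
  by rewrite subsetI (pHall_sub sylQ) sub_cent1 (subsetP abQ).
have sylPy : p.-Sylow(G) (P :^ y)%G by rewrite pHallJ.
have [||c /setIP[Gc /cent1P cuc] defP] :=
  Sylow_trans (sylC _ sylPy _ _) (sylC _ sylP abP Puy).
- by rewrite /= abelianJ.
- by rewrite memJ_conjg.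
have Nyc : y * c \in 'N_G(P).
  by rewrite inE groupM //= inE conjsgM -defP.
have /(subsetP sNC)/centP/(_ u Pu) cyc := Nyc.
have : u ^ (y * c) = u by rewrite /conjg -cyc mulKg.
by rewrite conjgM (conjgE _ c) -cuc mulKg.
Qed.

(* Burnside's transfer argument: by fusion control, the transfer of [G] into
   the abelian group [P] maps [g] in [P] to [g ^+ #|G : P|]. *)
Lemma abelian_Sylow_TI_der1 (gT : finGroupType) (p : nat)
    (G P : {group gT}) :
  p.-Sylow(G) P -> abelian P -> 'N_G(P) \subset 'C(P) -> P :&: G^`(1) = 1.
Proof.
move=> sylP abP sNC; have sPG := pHall_sub sylP.
have abI : abelian (idm P @* P) by rewrite morphim_abelian.
apply/trivgP/subsetP=> g /setIP[Pg G'g]; rewrite inE.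
have Gg := subsetP sPG g Pg.
have Vg1 : transfer_morphism G abI g = 1.
  have sub : G^`(1) \subset 'ker (transfer_morphism G abI).
    rewrite der1_min ?ker_norm // (isog_abelian (first_isog _)).
    by apply/centsP=> u _ v _; apply: FiniteModule.fmod_addrC.
  exact: (mker (subsetP sub g G'g)).
have trX := transversalP (rcosets_cycle_partition sPG Gg).
have := transfer_cycle_expansion sPG abI Gg trX.
set X := transversal _ _ in trX *; rewrite [LHS]Vg1.
move/(congr1 (@FiniteModule.fmval _ _ _)); rewrite FiniteModule.fmval_sum /=.
under eq_bigr => x Xx.
  have Gx : x \in G by apply: subsetP Xx; apply: transversal_sub trX.
  have := mulg_exp_card_rcosets P g x; rewrite mem_rcoset.
  rewrite -{1}[x]invgK -mulgA -conjgE => Pu.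
  rewrite (abelian_Sylow_fusion sylP abP sNC _ _ Pu) ?groupX ?groupV //.
  over.
under eq_bigr => x _.
  rewrite /restrm /= FiniteModule.fmodK /idm; last by rewrite /= morphim_idm ?groupX.
  over.
rewrite /= -(big_morph (fun n => g ^+ n) (expgnDr g) (expg0 g)).
rewrite (sum_index_rcosets_cycle sPG Gg trX) => /esym/eqP.
rewrite -order_dvdn => dv_g; rewrite -order_eq1 -dvdn1.
have /eqP <- : coprime #|P| #|G : P|.
  by have /and3P[_ pP p'i] := sylP; apply: (pnat_coprime pP p'i).
by rewrite dvdn_gcd dv_g order_dvdG.
Qed.

(** If a prime divided the order of the derived subgroup, the matching [P] would meet that subgroup
    in a nontrivial Sylow subgroup, against the transfer argument. *)
Lemma abelian_of_Sylow_NC (gT : finGroupType) (G : {group gT}) :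
  (forall p, prime p -> exists2 P : {group gT}, p.-Sylow(G) P &
     abelian P && ('N_G(P) \subset 'C(P))) ->
  abelian G.
Proof.
move=> sylNC; apply/derG1P/eqP; apply: contraT => ntG'.
have /pdivP[p p_pr dv_p] : (1 < #|G^`(1)|)%N by rewrite cardG_gt1.
have [P sylP /andP[abP sNC]] := sylNC p p_pr.
have := Sylow_setI_normal (der_normal 1 G) sylP.
rewrite setIC /= (abelian_Sylow_TI_der1 sylP abP sNC) => /card_Hall/esym/eqP.
by rewrite cards1 p_part_eq1 mem_primes p_pr cardG_gt0 dv_p.
Qed.

Lemma sub_of_prime_power_elts (gT : finGroupType) (G H : {group gT}) :
  (forall q x, prime q -> x \in G -> q.-elt x -> x \in H) -> G \subset H.
Proof.
move=> eltH; apply/subsetP=> x Gx; rewrite -(prod_constt x).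
apply: group_prod => q _; have [q_pr | q_npr] := boolP (prime q).
  by apply: (eltH q); rewrite ?p_elt_constt ?groupX.
(* For [q] not prime, [q] is never a prime divisor of [#[x]], so this constituent is 1. *)
suff /constt1P-> : q^'.-elt x by [].
apply/pnatP=> [|r r_pr _]; first exact: order_gt0.
by rewrite !inE; apply: contra q_npr => /eqP <-.
Qed.

(** * p-soluble groups and mutually permutable products: quotients and centralisers of [O_p] *)

(** A chief factor of [G / C] pulls back to a chief factor of [G] of the same order. *)
Lemma p_soluble_quotient (p : nat) (gT : finGroupType) (G C : {group gT}) :
  C <| G -> p_soluble p G -> p_soluble p (G / C).
Proof.
move=> nsCG solG V U /andP[maxV nsUG]; have [sCG nCG] := andP nsCG.
have [/andP[ltVU nVG] maxV'] := maxgroupP maxV.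
pose V1 := (coset C @*^-1 V)%G; pose U1 := (coset C @*^-1 U)%G.
have [sUG nUG] := andP nsUG.
have sVG := subset_trans (proper_sub ltVU) sUG.
have sV1G : V1 \subset G by rewrite sub_cosetpre_quo.
have sU1G : U1 \subset G by rewrite sub_cosetpre_quo.
have nsV1G : V1 <| G.
  by rewrite -(quotientGK nsCG) cosetpre_normal /normal sVG.
have nsU1G : U1 <| G by rewrite -(quotientGK nsCG) cosetpre_normal.
have nsCU1 : C <| U1 := normalS (sub_cosetpre U) sU1G nsCG.
have defV : V1 / C = V by rewrite cosetpreK.
have defU : U1 / C = U by rewrite cosetpreK.
have chief1 : chief_factor G V1 U1.
  rewrite /chief_factor nsU1G andbT; apply/maxgroupP; split.
    by rewrite cosetpre_proper ltVU (normal_norm nsV1G).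
  move=> W /andP[ltWU nWG] sVW.
  have sCW : C \subset W by apply: subset_trans sVW; apply: sub_cosetpre.
  have nsCW : C <| W.
    by rewrite /normal sCW (subset_trans _ nCG) // (subset_trans (proper_sub ltWU)).
  rewrite /= -(quotientGK nsCW) (maxV' (W / C)%G) //=.
  - by rewrite -defU quotient_proper // ?ltWU ?quotient_norms.
  by rewrite -defV quotientS.
have nsV1U1 : V1 <| U1.
  by rewrite (normalS _ sU1G nsV1G) // morphpreS // (proper_sub ltVU).
have card_eq : #|U1 / V1| = #|U / V|.
  have := card_isog (third_isog (sub_cosetpre V) nsCU1 nsV1U1).
  by rewrite /= defV defU.
by rewrite /pgroup -card_eq; apply: solG.
Qed.

Lemma p_soluble_minnormal (p : nat) (gT : finGroupType) (G M : {group gT}) :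
  p_soluble p G -> minnormal M G -> M \subset G ->
  p.-group M \/ p^'.-group M.
Proof.
move=> solG /mingroupP[/andP[ntM nMG] minM] sMG.
have := solG 1%G M; rewrite /pgroup -(card_isog (quotient1_isog M)); apply.
rewrite /chief_factor /normal sMG nMG !andbT; apply/maxgroupP.
rewrite proper1G ntM norms1; split=> // W /andP[/andP[sWM nMW] nWG] _.
apply/eqP; apply: contraNT nMW => ntW.
by rewrite (minM W) // ntW.
Qed.

Lemma mutually_permutable_product_sym (gT : finGroupType)
    (G A B : {group gT}) :
  mutually_permutable_product G A B -> mutually_permutable_product G B A.
Proof. by case=> defG pA pB; split; rewrite // -(pA B). Qed.

Lemma mutually_permutable_product_quotient (gT : finGroupType)
    (G A B C : {group gT}) :
  C <| G -> mutually_permutable_product G A B ->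
  mutually_permutable_product (G / C) (A / C) (B / C).
Proof.
move=> nsCG [defG pA pB]; have [_ nCG] := andP nsCG.
have [sAG sBG] : A \subset G /\ B \subset G by rewrite -defG mulG_subl mulG_subr.
have permQ (D E : {group gT}) : D \subset G -> E \subset G ->
    permutes_with_subgroups D E -> permutes_with_subgroups (D / C) (E / C).
  move=> sDG sEG pD Y sYE.
  have nCD := subset_trans sDG nCG; have nCE := subset_trans sEG nCG.
  (* Every subgroup of [E / C] is the image of a subgroup of [E], with which [D] permutes. *)
  have {1 2}-> : Y :=: ((E :&: coset C @*^-1 Y) / C).
    by rewrite quotientIG ?sub_cosetpre // cosetpreK (setIidPr sYE).
  have nCI : E :&: coset C @*^-1 Y \subset 'N(C) by rewrite subIset ?nCE.
  by rewrite -!quotientMl //= -(pD (E :&: coset C @*^-1 Y)%G) ?subsetIl ?quotientMl.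
split; try exact: permQ.
by rewrite -quotientMl ?defG // (subset_trans sAG).
Qed.

Lemma quotient_p_elt_liftU (gT : finGroupType) (q : nat)
    (A B C : {group gT}) (x : coset_of C) :
  A \subset 'N(C) -> B \subset 'N(C) -> x \in A / C :|: B / C -> q.-elt x ->
  exists y, [/\ y \in A :|: B, q.-elt y & x = coset C y].
Proof.
move=> nCA nCB ABx q_x.
have [y [Ny ABy def_x]] : exists y,
    [/\ y \in 'N(C), y \in A :|: B & x = coset C y].
  by case/setUP: ABx => /morphimP[y Ny Dy ->]; exists y; rewrite in_setU Dy ?orbT.
(* The [q]-part of any lift of a [q]-element is again a lift. *)
exists y.`_q; rewrite p_elt_constt; split=> //.
  by apply/setUP; case/setUP: ABy => Dy; [left | right]; apply: groupX.
by rewrite -(constt_p_elt q_x) def_x morph_constt.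
Qed.

(* Hall-Higman Lemma 1.2.3. *)
Lemma p_soluble_cent_pcore (p : nat) (gT : finGroupType) (G : {group gT}) :
  p_soluble p G -> 'O_p^'(G) = 1 -> 'C_G('O_p(G)) \subset 'O_p(G).
Proof.
move=> solG p'G1; set Z := 'O_p(G)%G; have nsZG : Z <| G := pcore_normal p G.
have [_ nZG] := andP nsZG; have pZ : p.-group Z := pcore_pgroup p G.
have nsCG : 'C_G(Z) <| G.
  by rewrite /normal subsetIl normsI ?normG ?norms_cent.
rewrite -quotient_sub1 ?subIset ?nZG //; apply: contraT => ntC.
have [] := @minnormal_exists _ (G / Z)%G ('C_G(Z) / Z)%G.
- by rewrite -subG1.
- by rewrite quotient_norms ?normal_norm.
move=> M minM sMC; have [/andP[ntM nMG] _] := mingroupP minM.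
have sMG : M \subset G / Z by rewrite (subset_trans sMC) ?quotientS ?subsetIl.
have nsMG : M <| G / Z by apply/andP.
pose U := ('C_G(Z) :&: coset Z @*^-1 M)%G.
have nsMU : coset Z @*^-1 M <| G by rewrite -(quotientGK nsZG) cosetpre_normal.
have nsUG : U <| G by rewrite normalI.
have defM : U / Z = M by rewrite quotientIG ?sub_cosetpre // cosetpreK (setIidPr sMC).
have nZU : U \subset 'N(Z) by rewrite (subset_trans _ nZG) ?normal_sub.
have [pM | p'M] := p_soluble_minnormal (p_soluble_quotient nsZG solG) minM sMG.
  (* Here [U] is a normal p-subgroup, so it lies in [Z] and [M] is trivial. *)
  case/negP: ntM; rewrite -subG1 -defM quotient_sub1 //.
  by apply: pcore_max => //; rewrite -(pquotient_pgroup pZ nZU) defM.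
(* Otherwise [Z :&: U] is a central Sylow p-subgroup of [U]. Its Schur-Zassenhaus complement [T] is
   then normal in [U], so it lies in the trivial p'-core of [U]. *)
have pW : p.-group (Z :&: U) by rewrite (pgroupS (subsetIl _ _)) ?pcore_pgroup.
have cWU : U \subset 'C(Z :&: U).
  by rewrite centsC subIset // centsC (subset_trans (subsetIl _ _)) ?subsetIr.
have nsWU : Z :&: U <| U by rewrite /normal subsetIr cents_norm.
have hallW : p.-Hall(U) (Z :&: U)%G.
  rewrite /pHall subsetIr pW -card_quotient ?normal_norm //=.
  by rewrite (card_isog (second_isog nZU)) /= defM.
have p'U1 : 'O_p^'(U) = 1.
  apply/trivgP; rewrite -p'G1 pcore_max ?pcore_pgroup //.
  exact: char_normal_trans (pcore_char _ _) nsUG.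
have /splitsP[T /complP[tiWT defU]] : [splits U, over Z :&: U].
  by rewrite SchurZassenhaus_split ?(pHall_Hall hallW).
have sTU : T \subset U by rewrite -defU mulG_subr.
case/negP: ntM; rewrite -subG1 -defM quotient_sub1 //.
suff /trivgP T1 : T \subset [1 gT] by rewrite -defU T1 mulg1 subsetIl.
rewrite -p'U1 pcore_max //.
  rewrite /pgroup; have <- : #|U : Z :&: U| = #|T|.
    by rewrite -divgS ?subsetIr // -defU TI_cardMg // mulKn.
  by case/and3P: hallW.
rewrite /normal sTU -{1}defU mulG_subG normG andbT.
by rewrite cents_norm // centsC (subset_trans sTU).
Qed.

(** The centraliser of [x] contains a Sylow p-subgroup [S] of [G], and the p-core of [G / K] lies in
    the image of [S]. *)
Lemma cent_pcore_of_class_size (p : nat) (gT : finGroupType)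
    (G K : {group gT}) (x : gT) :
  K <| G -> x \in G -> p^'.-nat #|x ^: G| -> coset K x \in 'C('O_p(G / K)).
Proof.
move=> nsKG Gx p'x; have nKG := normal_norm nsKG.
have [S sylS] := Sylow_exists p 'C_G[x].
have sSG : S \subset G by rewrite (subset_trans (pHall_sub sylS)) ?subsetIl.
have sylSG : p.-Sylow(G) S.
  rewrite /pHall sSG (pHall_pgroup sylS).
  rewrite -(Lagrange_index (subsetIl G 'C[x]) (pHall_sub sylS)).
  rewrite pnatM -index_cent1 in p'x *; rewrite p'x /=.
  by case/and3P: sylS.
have nKS := subset_trans sSG nKG.
apply: subsetP (centS (pcore_sub_Hall (quotient_pHall nKS sylSG))) _ _.
rewrite -sub_cent1; apply: quotient_cent1s.
by rewrite (subset_trans (pHall_sub sylS)) ?subsetIr.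
Qed.

(** * Permuting cyclic subgroups *)

(** Let [M] be the intersection of [K] with the group [A * <[y]>]. The index of [M :&: A] in [M]
    divides both [#|K|] and [#[y]], so it is 1. Hence [A :&: K] equals [M], which is normal in [A *
    <[y]>]. *)
Lemma pelt_norm_setI (p : nat) (gT : finGroupType) (A K : {group gT})
    (y : gT) :
  p^'.-group K -> A * <[y]> = <[y]> * A -> A <*> <[y]> \subset 'N(K) ->
  p.-elt y -> y \in 'N(A :&: K).
Proof.
move=> p'K cAy nKX p_y.
have defX : A <*> <[y]> = A * <[y]> by apply: comm_joingE.
have sAX : A \subset A <*> <[y]> by apply: joing_subl.
pose M := ((A <*> <[y]>) :&: K)%G.
have sMX : M \subset A <*> <[y]> by apply: subsetIl.
have nsMX : M <| A <*> <[y]> by rewrite /normal sMX normsI ?normG.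
have nMA := subset_trans sAX (normal_norm nsMX).
have p'i : p^'.-nat #|M : A|.
  by rewrite (pnat_dvd (dvdn_indexg _ _)) // [_.-nat _](pgroupS (subsetIr _ _) p'K).
have p_i : p.-nat #|M : A|.
  rewrite -indexMg -(comm_joingE (normC nMA)).
  have sAM : A <*> M \subset A <*> <[y]> by rewrite join_subG sAX.
  have := indexSg (joing_subl A M) sAM.
  by rewrite /= defX indexMg => /dvdn_trans/(_ (dvdn_indexg _ _))/pnat_dvd; apply.
have sMA : M \subset A by rewrite -indexg_eq1 (pnat_1 p_i p'i).
have -> : A :&: K = M.
  apply/eqP; rewrite eqEsubset subsetI sMA subsetIr andbT.
  by rewrite setSI.
by rewrite (subsetP (normal_norm nsMX)) // mem_gen // inE cycle_id orbT.
Qed.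

(* The product [<[a]> * <[b]>] is a group: it is the intersection of [K] with
   the groups [A * <[b]>] and [<[a]> * B]. *)
Lemma cycles_permute_of_TI (gT : finGroupType) (A B K : {group gT})
    (a b : gT) :
  A * <[b]> = <[b]> * A -> B * <[a]> = <[a]> * B -> A :&: B :&: K = 1 ->
  a \in A :&: K -> b \in B :&: K -> <[a]> * <[b]> = <[b]> * <[a]>.
Proof.
move=> cAb cBa tiABK /setIP[Aa Ka] /setIP[Bb Kb].
have sA : <[a]> \subset A by rewrite cycle_subG.
have sB : <[b]> \subset B by rewrite cycle_subG.
have sKa : <[a]> \subset K by rewrite cycle_subG.
have sKb : <[b]> \subset K by rewrite cycle_subG.
suff defX : <[a]> * <[b]> = (A <*> <[b]>) :&: (B <*> <[a]>) :&: K.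
  by apply/comm_group_setP; rewrite defX groupP.
rewrite comm_joingE // (comm_joingE cBa) cBa; apply/eqP; rewrite eqEsubset.
rewrite !subsetI mulSg // mulgS //= mul_subG //=.
apply/subsetP=> x /setIP[/setIP[X1x /imset2P[u v au Bv def_x]] Kx].
rewrite {x}def_x in X1x Kx *.
apply: mem_mulg => //.
have Kv : v \in K by rewrite -(groupMl _ (subsetP sKa u au)).
(* Writing [v = s * t] with [s] in [A] and [t] in [<[b]>] puts [s] in the trivial group
   [A :&: B :&: K]. *)
have : v \in A * <[b]>.
  by rewrite -[v](mulKg u) -(mulGid A) -mulgA mem_mulg // groupV (subsetP sA).
case/imset2P=> s t As bt def_v.
have : s \in A :&: B :&: K.
  rewrite !inE As -(groupMr _ (subsetP sB t bt)) -def_v Bv /=.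
  by rewrite -(groupMr _ (subsetP sKb t bt)) -def_v.
by rewrite tiABK => /set1P s1; rewrite def_v s1 mul1g.
Qed.

(** If [q = r], then [<[b]>] has prime index in the [r]-group [X], so it is normalised, hence
    centralised, by [a]. If not, [<[a]>] and [<[b]>] are Sylow subgroups of [X] and transfer makes
    [X] abelian. *)
Lemma prime_cycle_norm (gT : finGroupType) (G : {group gT}) (q r : nat)
    (a b : gT) :
  prime q -> prime r -> #[a] = q -> r.-elt b -> a \notin <[b]> ->
  <[a]> * <[b]> = <[b]> * <[a]> -> a \in G -> b \in G ->
  'N_G(<[a]>) \subset 'C[a] -> 'N_G(<[b]>) \subset 'C[b] ->
  commute a b.
Proof.
move=> q_pr r_pr oa r_b notba cab Ga Gb NCa NCb.
pose X := (<[a]> <*> <[b]>)%G.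
have defX : X :=: <[a]> * <[b]> by apply: comm_joingE.
have ti : <[a]> :&: <[b]> = 1 by rewrite prime_TIg -?orderE ?oa ?cycle_subG.
have cardX : #|X| = (q * #[b])%N by rewrite defX TI_cardMg // -!orderE oa.
have sXG : X \subset G by rewrite join_subG !cycle_subG Ga.
have [Xa Xb] : a \in X /\ b \in X.
  by rewrite !mem_gen // inE cycle_id ?orbT.
have [eq_qr | neq_qr] := eqVneq q r.
  have pX : r.-group X.
    by rewrite /pgroup cardX pnatM eq_qr pnat_id //; apply: r_b.
  have : <[b]> <| X.
    apply: (p_maximal_normal pX); apply: p_index_maximal; rewrite ?cycle_subG //.
    by rewrite -divgS ?cycle_subG //= cardX -orderE mulnK.
  move/normal_norm=> nbX.
  have /(subsetP NCb)/cent1P : a \in 'N_G(<[b]>) by rewrite inE Ga (subsetP nbX).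
  by [].
suff abX : abelian X by apply: (centsP abX).
have sylX (s : nat) (Y : {group gT}) : Y \subset X -> s.-group Y ->
    s^'.-nat (#|X| %/ #|Y|) -> s.-Sylow(X) Y.
  by move=> sYX sY s'i; rewrite /pHall sYX sY -divgS.
have NC_X c : 'N_G(<[c]>) \subset 'C[c] -> 'N_X(<[c]>) \subset 'C(<[c]>).
  by rewrite cent_cycle; apply: subset_trans; rewrite setSI.
apply: abelian_of_Sylow_NC => s s_pr.
have [-> | neq_sq] := eqVneq s q.
  exists <[a]>%G; last by rewrite cycle_abelian NC_X.
  apply: sylX; rewrite ?cycle_subG ?cardX //=.
    by rewrite /pgroup -orderE oa pnat_id.
  rewrite -orderE oa mulKn ?prime_gt0 //.
  by apply: sub_in_pnat r_b => t _ /eqP->; rewrite !inE eq_sym.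
have [-> | neq_sr] := eqVneq s r.
  exists <[b]>%G; last by rewrite cycle_abelian NC_X.
  apply: sylX; rewrite ?cycle_subG ?cardX //= -orderE mulnK //.
  by rewrite pnatE // !inE.
exists 1%G; last by rewrite abelian1 cent1T subsetT.
apply: sylX; rewrite ?sub1G ?pgroup1 //= cards1 divn1 cardX pnatM pnatE //.
rewrite !inE eq_sym neq_sq; apply: sub_in_pnat r_b => t _ /eqP->.
by rewrite !inE eq_sym.
Qed.

(** * Finding a normal cyclic p'-subgroup *)

Section CyclicCore.

(** This [G] will be the quotient by the centraliser of a minimal normal p-subgroup, and [K] its
    p'-core. *)
Variables (p : nat) (gT : finGroupType) (G A B K : {group gT}).
Hypothesis (defG : mutually_permutable_product G A B).
Hypotheses (nsKG : K <| G) (p'K : p^'.-group K).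
Hypothesis NC : forall q x, prime q -> q != p -> x \in A :|: B ->
  q.-elt x -> 'N_G(<[x]>) \subset 'C[x].
Hypothesis sylAB : forall q (Q : {group gT}), prime q -> q != p ->
  q.-group Q -> (Q \subset A) || (Q \subset B) -> cyclic Q.
Hypothesis eltK : forall q x, prime q -> q != p -> x \in A :|: B ->
  q.-elt x -> x \in K.

Let sAG : A \subset G. Proof. by case: defG => <-; rewrite mulG_subl. Qed.
Let sBG : B \subset G. Proof. by case: defG => <-; rewrite mulG_subr. Qed.

(** The Sylow subgroups of [D] are cyclic and, by [NC], centralised by their normalisers in [D]. So
    [D] is abelian by transfer, and then cyclic. *)
Lemma cyclic_sub_p'core (D : {group gT}) :
  (D \subset A) || (D \subset B) -> D \subset K -> cyclic D.
Proof.
move=> sD sDK; have DAB x : x \in D -> x \in A :|: B.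
  by case/orP: sD => /subsetP sD Dx; rewrite inE sD ?orbT.
have sDG : D \subset G by case/orP: sD => sD; apply: subset_trans sD _.
have cycQ q (Q : {group gT}) : prime q -> q.-group Q -> Q \subset D -> cyclic Q.
  move=> q_pr qQ sQD; have [eq_qp | neq_qp] := eqVneq q p.
    rewrite (card1_trivg (pnat_1 _ (pgroupS (subset_trans sQD sDK) p'K))) ?cyclic1 //.
    by rewrite -eq_qp.
  apply: (sylAB q_pr neq_qp qQ).
  by case/orP: sD => sD; rewrite (subset_trans sQD sD) ?orbT.
have abD : abelian D.
  apply: abelian_of_Sylow_NC => q q_pr; have [Q sylQ] := Sylow_exists q D.
  have sQD := pHall_sub sylQ; have qQ := pHall_pgroup sylQ.
  exists Q => //; have cQ := cycQ q Q q_pr qQ sQD; rewrite cyclic_abelian //=.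
  have [x defQ] := cyclicP cQ; have Qx : x \in Q by rewrite defQ cycle_id.
  have [eq_qp | neq_qp] := eqVneq q p.
    have -> : Q :=: 1.
      apply/card1_trivg/(pnat_1 qQ); rewrite eq_qp.
      exact: pgroupS (subset_trans sQD sDK) p'K.
    by rewrite cent1T subsetT.
  have q_x := mem_p_elt qQ Qx.
  have := NC q_pr neq_qp (DAB x (subsetP sQD x Qx)) q_x.
  by rewrite defQ cent_cycle; apply: subset_trans; rewrite setSI.
apply: nil_Zgroup_cyclic (abelian_nil abD).
apply/forall_inP=> Q /and3P[qQ sQD _].
have [-> | ntQ] := eqVneq (Q : {set gT}) 1; first exact: cyclic1.
have [q_pr _ _] := pgroup_pdiv qQ ntQ.
exact: cycQ q_pr qQ sQD.
Qed.

Lemma normal_cycle_of_setI_ntriv : A :&: K != 1 ->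
  exists q x, [/\ prime q, q != p, x \in A :|: B, q.-elt x &
    x != 1 /\ G \subset 'N(<[x]>)].
Proof.
case: (defG) => mulAB pA pB ntA0; have nKG := normal_norm nsKG.
have nKA := subset_trans sAG nKG; have nKB := subset_trans sBG nKG.
have cycA : cyclic (A :&: K).
  by apply: cyclic_sub_p'core; rewrite ?subsetIl ?subsetIr.
have cycB : cyclic (B :&: K).
  by apply: cyclic_sub_p'core; rewrite ?subsetIl ?orbT ?subsetIr.
have nA0A : A \subset 'N(A :&: K) by rewrite normsI ?normG.
have nB0B : B \subset 'N(B :&: K) by rewrite normsI ?normG.
have neq_p q x : x \in K -> #[x] = q -> prime q -> q != p.
  move=> Kx ox q_pr; have := mem_p_elt p'K Kx.
  by rewrite /p_elt ox pnatE // !inE.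
(* Subgroups of a cyclic group are characteristic. *)
have nKx (D E : {group gT}) x : cyclic (D :&: K) -> E \subset 'N(D :&: K) ->
    x \in D :&: K -> E \subset 'N(<[x]>).
  move=> cycD nDE Dx; apply: char_norm_trans nDE.
  by rewrite sub_cyclic_char // cycle_subG.
have [tiABK | ntABK] := eqVneq (A :&: B :&: K) 1; last first.
  have /pdivP[q q_pr q_dv] : (1 < #|A :&: B :&: K|)%N by rewrite cardG_gt1.
  have [x /setIP[/setIP[Ax Bx] Kx] ox] := Cauchy q_pr q_dv.
  exists q, x; split; rewrite ?inE ?Ax ?(neq_p q x) //.
    by rewrite /p_elt ox pnat_id.
  split; first by rewrite -order_gt1 ox prime_gt1.
  rewrite -mulAB mul_subG //; first by apply: (nKx A); rewrite // inE Ax.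
  by apply: (nKx B); rewrite // inE Bx.
have /pdivP[q q_pr q_dv] : (1 < #|A :&: K|)%N by rewrite cardG_gt1.
have [a A0a oa] := Cauchy q_pr q_dv; have [Aa Ka] := setIP A0a.
have neq_qp := neq_p q a Ka oa q_pr.
have q_a : q.-elt a by rewrite /p_elt oa pnat_id.
exists q, a; split; rewrite ?inE ?Aa //.
split; first by rewrite -order_gt1 oa prime_gt1.
rewrite -mulAB mul_subG //; first exact: (nKx A).
(* It remains to treat the elements [b] of [B] of prime power order. The p-elements normalise all of
   [A :&: K]; the others lie in [K] and turn out to commute with [a]. *)
suff: B \subset (B :&: 'N(<[a]>))%G by rewrite subsetI => /andP[].
apply: sub_of_prime_power_elts => r b r_pr Bb r_b; rewrite inE Bb /=.
have cAb : A * <[b]> = <[b]> * A by apply: pA; rewrite cycle_subG.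
have cBa : B * <[a]> = <[a]> * B by apply: pB; rewrite cycle_subG.
have Gb := subsetP sBG b Bb; have Ga := subsetP sAG a Aa.
have [eq_rp | neq_rp] := eqVneq r p.
  have nA0b : b \in 'N(A :&: K).
    apply: pelt_norm_setI p'K cAb _ _; last by rewrite -eq_rp.
    by rewrite join_subG nKA cycle_subG (subsetP nKG).
  by rewrite -cycle_subG; apply: (nKx A); rewrite ?cycle_subG.
have Kb : b \in K by apply: (eltK r_pr neq_rp); rewrite // inE Bb orbT.
have notba : a \notin <[b]>.
  apply: contraTN (prime_gt1 q_pr) => ba.
  have : a \in A :&: B :&: K by rewrite !inE Aa Ka (subsetP _ a ba) ?cycle_subG.
  by rewrite tiABK -oa => /set1P->; rewrite order1.
have cab := cycles_permute_of_TI cAb cBa tiABK A0a _.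
suff cab' : commute a b.
  by rewrite (subsetP (cent_sub _)) // cent_cycle; apply/cent1P.
apply: (prime_cycle_norm (G := G) q_pr r_pr oa r_b notba) => //.
- by apply: cab; rewrite inE Bb.
- by apply: (NC q_pr neq_qp); rewrite // inE Aa.
by apply: (NC r_pr neq_rp); rewrite // inE Bb orbT.
Qed.

End CyclicCore.

Lemma exists_normal_cycle (p : nat) (gT : finGroupType) (G A B : {group gT}) :
  prime p -> mutually_permutable_product G A B -> p_soluble p G ->
  'O_p(G) = 1 -> G :!=: 1 ->
  (forall q x, prime q -> q != p -> x \in A :|: B -> q.-elt x ->
     'N_G(<[x]>) \subset 'C[x]) ->
  (forall q (Q : {group gT}), prime q -> q != p -> q.-group Q ->
     (Q \subset A) || (Q \subset B) -> cyclic Q) ->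
  (forall q x, prime q -> q != p -> x \in A :|: B -> q.-elt x ->
     p^'.-nat #|x ^: G|) ->
  exists q x, [/\ prime q, q != p, x \in A :|: B, q.-elt x &
    x != 1 /\ G \subset 'N(<[x]>)].
Proof.
move=> p_pr defG solG Op1 ntG NC cycQ cls.
have [mulAB _ _] := defG.
have [sAG sBG] : A \subset G /\ B \subset G by rewrite -mulAB mulG_subl mulG_subr.
pose K := 'O_p^'(G)%G; have nsKG : K <| G := pcore_normal _ G.
have p'K : p^'.-group K := pcore_pgroup _ G.
(* Since its class has p'-size, the image of [x] in [G / K] centralises the p-core there, so it lies
   in that core by Hall-Higman. A p'-element of a p-group is trivial. *)
have eltK q x : prime q -> q != p -> x \in A :|: B -> q.-elt x -> x \in K.
  move=> q_pr neq_qp ABx q_x.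
  have Gx : x \in G by case/setUP: ABx; apply/subsetP.
  have cx := cent_pcore_of_class_size nsKG Gx (cls q x q_pr neq_qp ABx q_x).
  have := p_soluble_cent_pcore (p_soluble_quotient nsKG solG) (trivg_pcore_quotient _ _).
  move/subsetP/(_ (coset K x)); rewrite inE cx mem_quotient // => /(_ isT) Ox.
  apply: coset_idr; first exact: (subsetP (normal_norm nsKG)).
  apply/eqP; rewrite -order_eq1; apply/eqP.
  apply: (pnat_1 (mem_p_elt (pcore_pgroup p _) Ox)).
  apply: sub_in_pnat (morph_p_elt _ (subsetP (normal_norm nsKG) x Gx) q_x) => t _.
  by move/eqP->; rewrite !inE.
have [A0 | ntA] := eqVneq (A :&: K) 1; last first.
  exact: (normal_cycle_of_setI_ntriv defG nsKG p'K).
have [B0 | ntB] := eqVneq (B :&: K) 1; last first.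
  have [|||q [x [? ? ABx ? ?]]] := normal_cycle_of_setI_ntriv
      (mutually_permutable_product_sym defG) nsKG p'K _ _ _ ntB.
  - by move=> q x; rewrite setUC; apply: NC.
  - by move=> q Q; rewrite orbC; apply: cycQ.
  - by move=> q x; rewrite setUC; apply: eltK.
  by exists q, x; rewrite setUC.
(* If [A] and [B] both meet [K] trivially, they are p-groups, hence so is [G], against a trivial
   p-core. *)
have pAB (D : {group gT}) : D \subset A :|: B -> D :&: K = 1 -> p.-group D.
  move=> /subsetP sDAB D0; apply/pgroupP=> q q_pr q_dv; rewrite !inE.
  apply: contraT => neq_qp; have [x Dx ox] := Cauchy q_pr q_dv.
  have Kx : x \in K.
    by apply: (eltK q); rewrite ?sDAB // /p_elt ox pnat_id.
  have : x \in D :&: K by rewrite inE Dx.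
  by rewrite D0 => /set1P x1; move: q_pr; rewrite -ox x1 order1.
case/negP: ntG; rewrite -subG1 -Op1 pcore_max //.
have [pA pB] : p.-group A /\ p.-group B by rewrite !pAB ?subsetUl ?subsetUr.
have: p.-nat (#|A| * #|B|)%N by rewrite pnatM; apply/andP.
by rewrite mul_cardG mulAB pnatM => /andP[].
Qed.

(** * Class sizes and the action on an abelian normal p-subgroup *)

(** The quotient embeds in the automorphism group of [Q], which is cyclic for prime order. *)
Lemma norm_prime_quotient_cyclic (gT : finGroupType) (G Q : {group gT}) :
  prime #|Q| -> G \subset 'N(Q) -> cyclic (G / 'C_G(Q)).
Proof.
move=> prQ nQG; rewrite -ker_conj_aut.
rewrite (isog_cyclic (first_isog_loc _ nQG)).
exact: cyclicS (Aut_conj_aut _ _) (Aut_prime_cyclic prQ).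
Qed.

Lemma norm_prime_der1_cent (gT : finGroupType) (G Q : {group gT}) :
  prime #|Q| -> G \subset 'N(Q) -> G^`(1) \subset 'C(Q).
Proof.
move=> prQ nQG; apply: subset_trans (subsetIr G _).
rewrite der1_min ?normsI ?normG ?norms_cent //.
exact: cyclic_abelian (norm_prime_quotient_cyclic prQ nQG).
Qed.

(** This splits the index of ['C_G[x]] through [N <*> 'C_G[x]], separating the part of the class
    size seen on [N] from the part seen modulo the centraliser of [N]. *)
Lemma card_class_normal (gT : finGroupType) (G N : {group gT}) (x : gT) :
  N <| G -> #|x ^: G| = (#|G : N <*> 'C_G[x]| * #|N : 'C_N[x]|)%N.
Proof.
move=> /andP[sNG nNG]; rewrite -index_cent1.
have sCJ : 'C_G[x] \subset N <*> 'C_G[x] by apply: joing_subr.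
have sJG : N <*> 'C_G[x] \subset G by rewrite join_subG sNG subsetIl.
rewrite -(Lagrange_index sJG sCJ); congr (_ * _)%N.
have nNC : 'C_G[x] \subset 'N(N) by rewrite subIset ?nNG.
rewrite /= norm_joinEr // -(normC nNC) indexMg -indexgI setIA.
by rewrite (setIidPl sNG).
Qed.

(** By coprime action the fixed points of [x] in [N] cover [N / D], so [N] is the product of [D] and
    ['C_N(<[x]>)]. *)
Lemma stable_p'elt_cent (p : nat) (gT : finGroupType) (N D : {group gT})
    (x : gT) :
  p.-group N -> D \subset N -> N \subset 'N(D) -> p^'.-elt x ->
  x \in 'C(D) -> coset D x \in 'C(N / D) -> x \in 'C(N).
Proof.
move=> pN sDN nDN p'x cDx cQx; have nDx := subsetP (cent_sub D) x cDx.
have coNx : coprime #|N| #|<[x]>| by apply: pnat_coprime pN _.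
have nDX : <[x]> \subset 'N(D) by rewrite cycle_subG.
have := coprime_quotient_cent sDN nDX coNx (pgroup_sol pN).
have -> : 'C_(N / D)(<[x]> / D) = N / D.
  by apply/setIidPl; rewrite centsC quotient_cycle // cycle_subG.
move=> defQ; rewrite -sub_cent1 -cent_cycle -subsetIidl.
have defN : D * 'C_N(<[x]>) = N.
  by rewrite -quotientK ?subIset ?nDN //= defQ quotientGK // /normal sDN.
by rewrite -{1}defN mul_subG // subsetI sDN centsC cycle_subG.
Qed.

Section Faithful.

Variables (p : nat) (gT : finGroupType) (G N : {group gT}).
Hypotheses (p_pr : prime p) (nsNG : N <| G) (pN : p.-group N).
Hypothesis abN : abelian N.

Let C := 'C_G(N)%G.

Let sNG : N \subset G := normal_sub nsNG.
Let nNG : G \subset 'N(N) := normal_norm nsNG.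

Lemma centraliser_normal : C <| G.
Proof. by rewrite /normal subsetIl normsI ?normG ?norms_cent. Qed.

Let nCG : G \subset 'N(C) := normal_norm centraliser_normal.

(** The index is a power of [p] dividing the class size. *)
Lemma index_cent1_dvd x :
  ~~ (p ^ 2 %| #|x ^: G|)%N -> #|N : 'C_N[x]| %| p.
Proof.
rewrite (card_class_normal x nsNG).
have := dvdn_indexg N 'C_N[x]; have [n ->] := p_natP pN.
case/(dvdn_pfactor _ _ p_pr)=> [[|[|m]] _ ->] //; case/negP.
by rewrite dvdn_mull // dvdn_exp2l.
Qed.

Lemma index_cent1_eq x : x \in G -> x \notin C ->
  ~~ (p ^ 2 %| #|x ^: G|)%N -> #|N : 'C_N[x]| = p.
Proof.
move=> Gx notCx /index_cent1_dvd; case/primeP: p_pr => _ dv_p /dv_p/pred2P[] //.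
move/eqP; rewrite indexg_eq1 subsetI subxx sub_cent1 => cNx.
by case/negP: notCx; rewrite inE Gx.
Qed.

(** When [x] is outside [C], the index on [N] already takes the only factor [p] of the class size.
    The class size modulo [C] divides the other factor, [#|G : N <*> 'C_G[x]|]. *)
Lemma p'class_quotient x : x \in G -> ~~ (p ^ 2 %| #|x ^: G|)%N ->
  p^'.-nat #|coset C x ^: (G / C)|.
Proof.
move=> Gx p2x; have [Cx | notCx] := boolP (x \in C).
  by rewrite (coset_id Cx) class1G cards1.
have oN := index_cent1_eq Gx notCx p2x.
have p'i : p^'.-nat #|G : N <*> 'C_G[x]|.
  rewrite p'natE //; apply: contra p2x => p_dv.
  by rewrite (card_class_normal x nsNG) oN expnSr expn1 dvdn_pmul2r ?prime_gt0.
apply: pnat_dvd p'i.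
have sJ : N <*> 'C_G[x] \subset G by rewrite join_subG sNG subsetIl.
have sNC : N \subset C by rewrite subsetI sNG.
rewrite -index_cent1; apply: dvdn_trans (_ : #|G / C : (N <*> 'C_G[x]) / C| %| _).
  apply: indexgS; rewrite /= quotientY ?subIset ?nCG ?(subset_trans sNG) //.
  by rewrite join_subG (quotientS1 sNC) sub1G quotient_subcent1.
by apply: index_morphim; rewrite subIset ?nCG.
Qed.

(** Such a [y] is an element of [C] times a power of [x], and both factors centralise [n]. *)
Lemma cent1_sub_of_cycle x y n :
  x \in G -> y \in G -> coset C y \in <[coset C x]> -> n \in 'C_N[x] ->
  y \in 'C[n].
Proof.
move=> Gx Gy; rewrite -quotient_cycle ?(subsetP nCG) // => yC.
have nCx : <[x]> \subset 'N(C) by rewrite cycle_subG (subsetP nCG).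
have := mem_morphpre (subsetP nCG y Gy) yC; rewrite quotientK //.
case/imset2P=> c x' Cc xx' -> /setIP[Nn cxn].
have cC : C \subset 'C[n] by rewrite sub_cent1 (subsetP _ n Nn) // centsC subsetIr.
have sxC : <[x]> \subset 'C[n] by rewrite cycle_subG cent1C.
exact: groupM (subsetP cC c Cc) (subsetP sxC x' xx').
Qed.

Lemma norm_cent1_of_cycle x g :
  x \in G -> g \in G -> coset C (x ^ g) \in <[coset C x]> ->
  g \in 'N('C_N[x]).
Proof.
move=> Gx Gg xgC; rewrite -groupV inE sub_conjgV; apply/subsetP=> n Dn.
have Nn := subsetP (subsetIl _ _) n Dn.
have := cent1_sub_of_cycle Gx (groupJ Gx Gg) xgC Dn.
by rewrite conjIg (normP (subsetP nNG g Gg)) in_setI Nn -cent1J cent1C.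
Qed.

Lemma quotient_norm_cycle_cent1 (q : nat) f : q != p -> f \in G ->
  q.-elt f -> ~~ (p ^ 2 %| #|f ^: G|)%N ->
  'N_(G / C)(<[coset C f]>) \subset 'C[coset C f].
Proof.
move=> neq_qp Gf q_f p2f; have Cn := subsetP nCG.
have [Cf | notCf] := boolP (f \in C).
  by rewrite (coset_id Cf) cent11T subsetT.
have oN := index_cent1_eq Gf notCf p2f; pose D := 'C_N[f]%G.
have sDN : D \subset N by apply: subsetIl.
have nDN : N \subset 'N(D) by rewrite sub_abelian_norm.
apply/subsetP=> _ /setIP[/morphimP[g Ng Gg ->]] nfg.
have fgC : coset C (f ^ g) \in <[coset C f]>.
  by rewrite morphJ ?Cn //= memJ_norm ?cycle_id.
have nDg : g \in 'N(D) by apply: norm_cent1_of_cycle.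
have nDf : f \in 'N(D) by apply: norm_cent1_of_cycle; rewrite // conjgE mulKg cycle_id.
have prQ : prime #|N / D| by rewrite card_quotient // oN.
have [c [i [Cc def_fg]]] : exists c i, c \in C /\ f ^ g = c * f ^+ i.
  move: fgC; rewrite -quotient_cycle ?Cn // => fgC.
  have nCf : <[f]> \subset 'N(C) by rewrite cycle_subG Cn.
  have := mem_morphpre (Cn _ (groupJ Gf Gg)) fgC.
  rewrite quotientK // => /imset2P[c _ Cc /cycleP[i ->] ->].
  by exists c, i.
have [Gc cNc] := setIP Cc.
(* The aim is [f'] in [C]. As a power of [f] it is a p'-element centralising [D], so only its action
   on [N / D] is left. *)
pose f' := f ^+ i * f^-1.
have ff' : f' \in <[f]> by rewrite groupM ?groupV ?mem_cycle ?cycle_id.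
have p'f' : p^'.-elt f'.
  apply: (mem_p_elt _ ff'); apply: sub_in_pnat q_f => t _ /eqP->.
  by rewrite !inE.
have def_f' : f' = c^-1 * (f ^ g * f^-1) by rewrite def_fg /f' !mulgA mulVg mul1g.
have nDc : c \in 'N(D) by rewrite (subsetP (cent_sub _)) // (subsetP (centS sDN)).
have cQ : coset D f' \in 'C(N / D).
  have cQc : coset D c \in 'C(N / D).
    by rewrite -sub_cent1 quotient_cent1s // sub_cent1.
  have nDfg : f ^ g * f^-1 \in 'N(D) by rewrite groupM ?groupJ ?groupV.
  rewrite def_f' morphM ?groupV //= groupM ?morphV ?groupV //=.
  have -> : f ^ g * f^-1 = [~ g, f^-1].
    by rewrite /commg /conjg invgK !mulgA.
  (* Up to [c], which acts trivially, [f'] is a commutator in [X], and [X] induces an abelian group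
     on [N / D], of order [p]. *)
  pose X := <<[set f; g]>>%G.
  have sXD : X \subset 'N(D) by rewrite gen_subG subUset !sub1set nDf.
  have sXG : X \subset G by rewrite gen_subG subUset !sub1set Gf.
  have nQX : X / D \subset 'N(N / D).
    by rewrite quotient_norms // (subset_trans sXG).
  have := norm_prime_der1_cent prQ nQX; rewrite -quotient_der // => /subsetP; apply.
  rewrite mem_quotient // mem_commg ?groupV ?mem_gen ?inE ?eqxx ?orbT //.
have cNf' : f' \in 'C(N).
  apply: (stable_p'elt_cent pN sDN nDN p'f' _ cQ).
  by apply: subsetP ff'; rewrite cycle_subG -sub_cent1 subsetIr.
have Cf' : f' \in C by rewrite inE cNf' groupM ?groupX ?groupV.
have : coset C (f ^ g) = coset C f.
  have -> : f ^ g = c * f' * f by rewrite def_f' mulKVg mulgKV.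
  by rewrite coset_kerl // groupM.
rewrite morphJ ?Cn //= => /conjg_fixP/commgP cfg.
by apply/cent1P.
Qed.

(** A Sylow [q]-subgroup of the preimage of [Q] in [E] maps onto [Q]. *)
Lemma quotient_pgroup_lift (q : nat) (E : {group gT}) (Q : {group coset_of C}) :
  E \subset G -> Q \subset E / C -> q.-group Q ->
  exists2 R : {group gT}, R \subset E /\ q.-group R & R / C = Q.
Proof.
move=> sEG sQE qQ; have nCE := subset_trans sEG nCG.
pose H := (E :&: coset C @*^-1 Q)%G.
have defQ : H / C = Q by rewrite quotientIG ?sub_cosetpre // cosetpreK (setIidPr sQE).
have [R sylR] := Sylow_exists q H; exists R.
  by rewrite (pHall_pgroup sylR) (subset_trans (pHall_sub sylR)) ?subsetIl.
have nCR : R \subset 'N(C).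
  by rewrite (subset_trans (pHall_sub sylR)) // subIset ?nCE.
have := quotient_pHall nCR sylR; rewrite defQ => sylRC.
by apply: esym; apply: (sub_pHall sylRC) => //; apply: pHall_sub sylRC.
Qed.

(** Take [z] in [R] with nontrivial central image in [R / C]. Then [D = 'C_N[z]] is [R]-invariant of
    index [p] in [N], and the claim [kerR] shows that [R / C] acts faithfully on [N / D]. *)
Lemma quotient_pgroup_cyclic (q : nat) (R : {group gT}) : q != p ->
  R \subset G -> q.-group R ->
  (forall x, x \in R -> ~~ (p ^ 2 %| #|x ^: G|)%N) -> cyclic (R / C).
Proof.
move=> neq_qp sRG qR p2R; have Cn := subsetP nCG; have Gr := subsetP sRG.
have [-> | ntQ] := eqVneq (R / C) 1; first exact: cyclic1.
have qQ : q.-group (R / C) by apply: quotient_pgroup.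
have ntZ : 'Z(R / C) != 1 by apply: contraNneq ntQ => /(trivg_center_pgroup qQ)->.
have [_ /setIP[/morphimP[z Nz Rz ->] cQz] ntz] := trivgPn _ ntZ.
have Gz := Gr z Rz.
have notCz : z \notin C by apply: contraNN ntz => Cz; apply/eqP; apply: coset_id.
have oN := index_cent1_eq Gz notCz (p2R z Rz); pose D := 'C_N[z]%G.
have sDN : D \subset N by apply: subsetIl.
have nDN : N \subset 'N(D) by rewrite sub_abelian_norm.
have nDR : R \subset 'N(D).
  apply/subsetP=> g Rg; apply: norm_cent1_of_cycle; rewrite ?Gr //.
  rewrite morphJ ?Cn ?Gr //= conjgE (centP cQz) ?mem_quotient //.
  by rewrite mulKg cycle_id.
have Dn := subsetP nDR.
have p'R x : x \in R -> p^'.-elt x.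
  move=> Rx; apply: sub_in_pnat (mem_p_elt qR Rx) => t _ /eqP->.
  by rewrite !inE.
have kerR g : g \in R -> coset D g \in 'C(N / D) -> g \in C.
  move=> Rg cQg; apply: contraT => notCg; have Rgz := groupM Rg Rz.
  have cDz : z \in 'C(D) by rewrite -sub_cent1 subsetIr.
  have tiQz : 'C_(N / D)(<[z]> / D) = 1.
    have nDz : <[z]> \subset 'N(D) by rewrite cycle_subG Dn.
    have coNz : coprime #|N| #|<[z]>| by apply: pnat_coprime pN (p'R z Rz).
    rewrite -(coprime_quotient_cent sDN nDz coNz (pgroup_sol pN)).
    by rewrite cent_cycle trivg_quotient.
  (* On [N / D] the element [g * z] acts as [z], hence without nontrivial fixed points. *)
  have sED : 'C_N[g * z] \subset D.
    apply/subsetP=> n /setIP[Nn cgzn]; have nDn := subsetP nDN n Nn.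
    suff : coset D n \in 'C_(N / D)(<[z]> / D).
      by rewrite tiQz => /set1P; apply: coset_idr.
    rewrite inE mem_quotient //= quotient_cycle ?Dn // cent_cycle.
    have : coset D n \in 'C[coset D (g * z)].
      by rewrite (subsetP (quotient_cent1 _ _)) ?mem_quotient.
    rewrite morphM ?Dn // cent1C => cgz.
    have cgn : coset D g \in 'C[coset D n].
      by apply/cent1P; apply: (centP cQg); rewrite mem_quotient.
    by rewrite cent1C -(groupMl _ cgn).
  (* The index of ['C_N[g * z]] divides [p], which is the index of [D]. So [g * z] and [z] both
     centralise [D], and thus [g] does. *)
  have defD : D :=: 'C_N[g * z].
    apply/eqP; rewrite eqEsubset sED andbT -indexg_eq1.
    have := index_cent1_dvd (p2R _ Rgz).
    rewrite -(Lagrange_index sDN sED) oN -{2}[p]muln1 dvdn_pmul2l ?prime_gt0 //.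
    by rewrite dvdn1.
  have cDgz : g * z \in 'C(D) by rewrite defD -sub_cent1 subsetIr.
  have cDg : g \in 'C(D) by rewrite -(groupMr _ cDz).
  case/negP: notCg; rewrite inE Gr //.
  exact: (stable_p'elt_cent pN sDN nDN (p'R g Rg) cDg cQg).
have prQ : prime #|N / D| by rewrite card_quotient // oN.
have nQR : R / D \subset 'N(N / D) by rewrite quotient_norms // (subset_trans sRG).
have /cyclicP[y0 defy] := norm_prime_quotient_cyclic prQ nQR.
(* A generator of the group induced on [N / D] lifts to [y] in [R]; modulo [C], each [g] in [R] is a
   power of [y] by [kerR]. *)
have /morphimP[y1 Ny1 /morphimP[y Ny Ry def_y1] def_y0] :
    y0 \in R / D / 'C_(R / D)(N / D).
  by rewrite defy cycle_id.
apply/cyclicP; exists (coset C y); apply/eqP; rewrite eqEsubset cycle_subG.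
rewrite mem_quotient // andbT; apply/subsetP=> _ /morphimP[g Ng Rg ->].
have Qg : coset D g \in R / D by rewrite mem_quotient.
have nK : R / D \subset 'N('C_(R / D)(N / D)) by rewrite normsI ?normG ?norms_cent.
have : coset 'C_(R / D)(N / D) (coset D g) \in <[y0]> by rewrite -defy mem_quotient.
rewrite def_y0 def_y1 => /cycleP[i].
have Qy : coset D (y ^+ i) \in R / D by rewrite mem_quotient ?groupX.
rewrite -morphX // -?morphX ?(subsetP nK) ?mem_quotient //= => eq_gy.
have : coset D g \in 'C_(R / D)(N / D) :* coset D (y ^+ i).
  by apply/rcoset_kercosetP; rewrite ?(subsetP nK).
rewrite mem_rcoset -morphV -?morphM ?groupV ?groupX ?Dn //=.
case/setIP=> _ cQgy; have Rgy : g * (y ^+ i)^-1 \in R by rewrite groupM ?groupV ?groupX.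
have Cgy := kerR _ Rgy cQgy.
have -> : coset C g = coset C (y ^+ i) by rewrite -[g](mulgKV (y ^+ i)) coset_kerl.
by rewrite morphX ?Cn ?Gr //= mem_cycle.
Qed.

End Faithful.

(** * Minimal normal p-subgroups have order p *)

(** The preimage [R] of the p-core is [P * C] with [P] a p-group. As [N <*> P] is nilpotent, [N]
    meets its centre, so [R] has nontrivial fixed points on [N]; by minimality [R] centralises
    [N]. *)
Lemma pcore_quotient_cent_minnormal (p : nat) (gT : finGroupType)
    (G N : {group gT}) :
  minnormal N G -> N \subset G -> p.-group N -> 'O_p(G / 'C_G(N)) = 1.
Proof.
move=> minN sNG pN; have [/andP[ntN nNG] minN'] := mingroupP minN.
pose C := 'C_G(N)%G.
have nsCG : C <| G by rewrite /normal subsetIl normsI ?normG ?norms_cent.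
pose R := (coset C @*^-1 'O_p(G / C))%G.
have nsRG : R <| G by rewrite -(quotientGK nsCG) cosetpre_normal pcore_normal.
have defR : R / C = 'O_p(G / C) by rewrite cosetpreK.
have [sRG nRG] := andP nsRG; have nCR := subset_trans sRG (normal_norm nsCG).
have [P sylP] := Sylow_exists p R; have [sPR pP _] := and3P sylP.
have nCP := subset_trans sPR nCR.
have defP : P / C = R / C.
  have sylPC := quotient_pHall nCP sylP.
  have pRC : p.-group (R / C) by rewrite defR pcore_pgroup.
  apply/esym/(sub_pHall sylPC) => //; last exact: pHall_sub sylPC.
have nNP : P \subset 'N(N) := subset_trans (subset_trans sPR sRG) nNG.
have pNP : p.-group (N <*> P) by rewrite norm_joinEr // pgroupM pN.
have nsN : N <| N <*> P by rewrite /normal joing_subl join_subG normG.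
have ntNP : N :&: 'Z(N <*> P) != 1 by rewrite meet_center_nil ?(pgroup_nil pNP).
have sRPC : R \subset P * C.
  by rewrite (normC nCP) -quotientK // defP quotientGK // (normalS _ sRG) ?sub_cosetpre.
have cR : N :&: 'Z(N <*> P) \subset 'C_N(R).
  rewrite subsetI subsetIl centsC (subset_trans sRPC) // mul_subG //.
    by rewrite centsC subIset // (subset_trans (subsetIr _ _)) ?orbT // centS ?joing_subr.
  by rewrite centsC (subset_trans (subsetIl _ _)) // centsC subsetIr.
have defN : 'C_N(R) = N.
  apply: (minN' 'C_N(R)%G); rewrite ?subsetIl //=.
  rewrite normsI ?norms_cent // andbT; apply: contraNneq ntNP => CN1.
  by rewrite -subG1 -CN1.
rewrite -/C -defR; apply/trivgP; rewrite quotient_sub1 //.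
by rewrite subsetI sRG centsC -defN subsetIr.
Qed.

Lemma card_minnormal_pgroup (p : nat) (gT : finGroupType)
    (G A B N : {group gT}) :
  prime p -> mutually_permutable_product G A B -> p_soluble p G ->
  (forall q x, prime q -> q != p -> x \in A :|: B -> q.-elt x ->
     ~~ (p ^ 2 %| #|x ^: G|)%N) ->
  minnormal N G -> N \subset G -> p.-group N -> #|N| = p.
Proof.
move=> p_pr defG solG cls minN sNG pN.
have [/andP[ntN nNG] minN'] := mingroupP minN; have [mulAB _ _] := defG.
have [sAG sBG] : A \subset G /\ B \subset G by rewrite -mulAB mulG_subl mulG_subr.
have nsNG : N <| G by apply/andP.
have abN : abelian N.
  have [_ _ /is_abelemP[r _ /abelem_abelian]] //:=
    minnormal_solvable minN (subxx _) (pgroup_sol pN).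
pose C := 'C_G(N)%G.
have nsCG : C <| G := centraliser_normal nsNG; have nCG := normal_norm nsCG.
have Op1 : 'O_p(G / C) = 1 := pcore_quotient_cent_minnormal minN sNG pN.
have sABG : A :|: B \subset G by rewrite subUset sAG.
have nCA := subset_trans sAG nCG; have nCB := subset_trans sBG nCG.
have lift q x := @quotient_p_elt_liftU _ q A B C x nCA nCB.
(* If [N] is central, any subgroup of order [p] in it is normal in [G]. *)
have [G1 | ntG] := eqVneq (G / C) 1.
  have cNG : G \subset 'C(N).
    have: G \subset C by rewrite -quotient_sub1 // G1.
    by rewrite subsetI subxx.
  have /pdivP[r r_pr r_dv] : (1 < #|N|)%N by rewrite cardG_gt1.
  have eq_rp : r = p.
    have := pnatPpi pN; rewrite /= => /(_ r); rewrite mem_primes r_pr r_dv cardG_gt0.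
    by move=> /(_ isT)/eqP.
  have [x Nx ox] := Cauchy r_pr r_dv.
  rewrite -(minN' <[x]>%G); first by rewrite -orderE ox.
    rewrite cycle_eq1 -order_gt1 ox prime_gt1 //= cents_norm //.
    by rewrite (subset_trans cNG) // centS // cycle_subG.
  by rewrite cycle_subG.
have gtG x : x \in A :|: B -> x \in G := subsetP sABG x.
have [|||q [x [q_pr neq_qp ABx q_x [ntx nxG]]]] :=
  exists_normal_cycle p_pr (mutually_permutable_product_quotient nsCG defG)
    (p_soluble_quotient nsCG solG) Op1 ntG.
- move=> q x q_pr neq_qp ABx /(lift _ _ ABx)[y [ABy q_y ->]].
  by apply: (quotient_norm_cycle_cent1 p_pr nsNG pN abN neq_qp); rewrite ?gtG ?(cls q).
- move=> q Q q_pr neq_qp qQ sQ.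
  have [E sEG [sEAB sQE]] : exists2 E : {group gT}, E \subset G &
      E \subset A :|: B /\ Q \subset E / C.
    by case/orP: sQ; [exists A | exists B]; rewrite ?subsetUl ?subsetUr.
  have [R [sRE qR] <-] := quotient_pgroup_lift nsNG sEG sQE qQ.
  apply: (quotient_pgroup_cyclic p_pr nsNG pN abN neq_qp) => //.
    exact: subset_trans sRE sEG.
  move=> x Rx; apply: (cls q) => //; last exact: mem_p_elt qR Rx.
  exact: subsetP sEAB x (subsetP sRE x Rx).
- move=> q x q_pr neq_qp ABx /(lift _ _ ABx)[y [ABy q_y ->]].
  by apply: p'class_quotient; rewrite ?gtG ?(cls q).
have [y [ABy q_y def_x]] := lift _ _ ABx q_x; have Gy := gtG y ABy.
have nDG : G \subset 'N('C_N[y]).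
  apply/subsetP=> g Gg; apply: (norm_cent1_of_cycle nsNG Gy Gg).
  rewrite morphJ ?(subsetP nCG) //= -def_x memJ_norm ?cycle_id //.
  by rewrite (subsetP nxG) ?mem_quotient.
(* By minimality the normal subgroup ['C_N[y]] is 1 or [N], and the latter would make [x]
   trivial. *)
have D1 : 'C_N[y] = 1.
  apply/eqP; apply: contraNT ntx => ntD.
  have defD : 'C_N[y] = N by apply: (minN' 'C_N[y]%G); rewrite ?ntD ?subsetIl.
  rewrite def_x coset_id // inE Gy -sub_cent1 -defD subsetIr //.
have := index_cent1_dvd p_pr nsNG pN (cls q y q_pr neq_qp ABy q_y).
rewrite D1 indexg1.
case/primeP: p_pr => _ dv_p /dv_p/pred2P[] // /eqP.
by rewrite -trivg_card1 (negPf ntN).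
Qed.

Theorem theoremC (gT : finGroupType) (G A B : {group gT}) (p : nat)
    (p_pr : prime p)
    (defG : mutually_permutable_product G A B)
    (class_size : forall x : gT, x \in A :|: B ->
       prime_power_order x -> p^'.-elt x -> ~~ (p ^ 2 %| #|x ^: G|)%N)
    (solG : p_soluble p G) :
  p_supersoluble p G.
Proof.
move=> V U chiefU; have [pU | p'U] := solG V U chiefU; [left | by right].
have minU := chief_factor_minnormal chiefU.
have [/maxgroupp/andP[_ nVG] /andP[sUG _]] := andP chiefU.
have [mulAB _ _] := defG.
have [sAG sBG] : A \subset G /\ B \subset G by rewrite -mulAB mulG_subl mulG_subr.
have nsVG : V <| G.
  rewrite /normal nVG andbT (subset_trans _ sUG) //.
  by case/andP: chiefU => /maxnormal_sub.
have cls (q : nat) x : prime q -> q != p -> x \in A :|: B -> q.-elt x ->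
    ~~ (p ^ 2 %| #|x ^: G|)%N.
  (* The identity is not of prime power order in the sense used, so its class is treated
     directly. *)
  move=> q_pr neq_qp ABx q_x; have [-> | ntx] := eqVneq x 1.
    by rewrite class1G cards1 dvdn1 -(expn0 p) eqn_exp2l ?prime_gt1.
  apply: class_size => //.
    have [n ox] := p_natP q_x; exists q, n; split=> //.
    by rewrite lt0n; apply: contraNneq ntx => n0; rewrite -order_eq1 ox n0.
  by apply: sub_in_pnat q_x => t _ /eqP->; rewrite !inE.
apply: (card_minnormal_pgroup p_pr (mutually_permutable_product_quotient nsVG defG)
  (p_soluble_quotient nsVG solG) _ minU _ pU); last by rewrite quotientS.
move=> q x q_pr neq_qp ABx q_x.
have [y [ABy q_y ->]] :=
  quotient_p_elt_liftU (subset_trans sAG nVG) (subset_trans sBG nVG) ABx q_x.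
(* Class sizes in [G / V] divide those of lifts in [G]. *)
apply: contra (cls q y q_pr neq_qp ABy q_y) => /dvdn_trans; apply.
have Gy : y \in G by case/setUP: ABy; apply/subsetP.
rewrite -!index_cent1; apply: dvdn_trans (_ : #|G / V : 'C_G[y] / V| %| _).
  by apply: indexgS; apply: quotient_subcent1.
by apply: index_morphim; rewrite subIset ?nVG.
Qed.
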